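(* Let $G$ be the directed path graph of a (finite) dynamical trajectory, i.e. the network on points $v_1,\dots,v_m$ ($m\ge1$) whose edges are exactly $v_i\to v_{i+1}$ for $1\le i<m$, let $\pi$ be a partition of its vertex set into nonempty cells (bins), and let $G^\pi$ be the quotient graph. Then the maximal Dowker source complex and the maximal Dowker sink complex of the path completion $P(G^\pi)$ are contractible.
   Context: A network $G=(X,\omega)$ is a finite vertex set $X$ with $\omega:X\times X\to[0,\infty]$; pairs with finite weight are edges. The weight of a path $(x_0,\dots,x_m)$ is $\sum_i\omega(x_i,x_{i+1})$ ($0$ for a constant path), $d(x,y)$ is the infimum of the weights of paths from $x$ to $y$, and $P(G)=(X,d)$ is the path completion. Given a digraph $G$ and a partition $\pi$ of its vertices, the quotient graph $G^\pi$ has the cells of $\pi$ as vertices, with an edge (of some finite nonnegative weight; e.g. weight $1$ in the unweighted case) from a cell $A$ to a different cell $B$ if and only if $G$ has an edge from a vertex of $A$ to a vertex of $B$. For finite real $\delta\ge0$, the Dowker source (resp. sink) complex of a path completion $(X,d)$ has as simplices the nonempty $\sigma\subseteq X$ for which there is $y\in X$ with $d(y,x)\le\delta$ (resp. $d(x,y)\le\delta$) for all $x\in\sigma$. As $X$ is finite, these complexes are constant for all sufficiently large finite $\delta$, and this eventual complex is called the maximal one. *)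

(* Defs.v *)
From HB Require Import structures.
From mathcomp Require Import all_boot all_order all_algebra.
From mathcomp Require Import all_classical all_reals.
From mathcomp Require Import ereal topology normedtype.

Set Implicit Arguments.
Unset Strict Implicit.
Unset Printing Implicit Defensive.

Import Order.TTheory GRing.Theory Num.Theory.
Import numFieldNormedType.Exports.

Local Open Scope classical_set_scope.
Local Open Scope ring_scope.
Local Open Scope ereal_scope.

(* classical_sets shadows several names of finset; whenever a finite set (type
   {set T}) is meant, the finset name is written qualified. *)

Record network (R : realType) (X : finType) := Network {
  weight :> X -> X -> \bar R;
  weight_ge0 : forall x y, 0 <= weight x y }.

Definition edge (R : realType) (X : finType) (G : network R X) : rel X :=
  fun x y => G x y < +oo.

(* A path is a starting vertex x together with the list s of its remaining
   vertices; s = [::] is the constant path at x. *)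
Definition path_weight (R : realType) (X : finType) (G : network R X)
  (x : X) (s : seq X) : \bar R := \sum_(w <- pairmap G x s) w.

(* The infimum of the empty set is +oo: y is at infinite distance from x when
   there is no path from x to y. *)
Definition dist (R : realType) (X : finType) (G : network R X) (x y : X) :
    \bar R :=
  ereal_inf [set path_weight G x s | s in
    [set s | path (edge G) x s /\ last x s = y]].

Lemma dist_ge0 (R : realType) (X : finType) (G : network R X) (x y : X) :
  0 <= dist G x y.
Proof.
apply: le_ereal_inf_tmp => _ [s _ <-]; rewrite /path_weight.
elim: s x => [|z s IHs] x /=; first by rewrite big_nil.
by rewrite big_cons adde_ge0// weight_ge0.
Qed.

Definition path_completion (R : realType) (X : finType) (G : network R X) :
  network R X := Network (@dist_ge0 R X G).

Definition dowker_source (R : realType) (X : finType) (D : network R X)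
    (delta : R) : {set {set X}} :=
  finset (fun s : {set X} => (s != finset.set0) &&
    [exists y, [forall x in s, D y x <= delta%:E]]).

Definition dowker_sink (R : realType) (X : finType) (D : network R X)
    (delta : R) : {set {set X}} :=
  finset (fun s : {set X} => (s != finset.set0) &&
    [exists y, [forall x in s, D x y <= delta%:E]]).

(* The eventual value of a one-parameter family of complexes, as the set of
   those simplices that are eventually present; see maximal_sourceP and
   maximal_sinkP. *)
Definition maximal_complex (R : realType) (X : finType)
    (F : R -> {set {set X}}) : {set {set X}} :=
  finset (fun s : {set X} => `[< \forall delta \near +oo%R, s \in F delta >]).

Lemma maximal_complexP (R : realType) (X : finType) (F : R -> {set {set X}}) :
  (forall d e : R, (d <= e)%R -> F d \subset F e) ->
  \forall delta \near +oo%R, F delta = maximal_complex F.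
Proof.
move=> Fmon.
have Fs s : \forall d \near +oo%R, (s \in F d) = (s \in maximal_complex F).
  rewrite inE; case: asboolP => [//|Ns].
  apply: nearW => d; apply/negP => sd; apply: Ns.
  apply: filterS (nbhs_pinfty_ge (num_real d)) => e de.
  exact: (fintype.subsetP (Fmon d e de)).
have: \forall d \near +oo%R,
    forall s, (s \in F d) = (s \in maximal_complex F).
  exact: filter_forall.
by apply: filterS => d Fd; apply/setP.
Qed.

Lemma maximal_sourceP (R : realType) (X : finType) (D : network R X) :
  \forall delta \near +oo%R,
    dowker_source D delta = maximal_complex (dowker_source D).
Proof.
apply: maximal_complexP => d e de; apply/fintype.subsetP => s.
rewrite !inE => /andP[-> /existsP[y /forall_inP ys]].
apply/existsP; exists y; apply/forall_inP => x /ys xd.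
by rewrite (le_trans xd)// lee_fin.
Qed.

Lemma maximal_sinkP (R : realType) (X : finType) (D : network R X) :
  \forall delta \near +oo%R,
    dowker_sink D delta = maximal_complex (dowker_sink D).
Proof.
apply: maximal_complexP => d e de; apply/fintype.subsetP => s.
rewrite !inE => /andP[-> /existsP[y /forall_inP ys]].
apply/existsP; exists y; apply/forall_inP => x /ys xd.
by rewrite (le_trans xd)// lee_fin.
Qed.

(* The underlying space of a complex, in barycentric coordinates. *)
Definition realization (R : realType) (X : finType) (K : {set {set X}}) :
    set {ptws X -> R} :=
  [set t | [/\ forall x, (0 <= t x)%R,
               (\sum_x t x = 1)%R &
               finset (fun x => t x != 0%R) \in K]].

(* Contractibility of a subspace A: the identity of A is homotopic, within A,
   to a constant map.  In particular A is nonempty. *)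
Definition contractible (R : realType) (T : topologicalType) (A : set T) :=
  exists2 a : T, A a & exists H : R * T -> T,
    [/\ {within `[0%R, 1%R]%classic `*` A, continuous H},
        forall t x, (0 <= t <= 1)%R -> A x -> A (H (t, x)),
        forall x, A x -> H (0%R, x) = x &
        forall x, A x -> H (1%R, x) = a].

Definition contractible_complex (R : realType) (X : finType)
    (K : {set {set X}}) : Prop :=
  contractible R (@realization R X K).

(* The index i : 'I_m is 0-based, so v i is the (i+1)-st point. *)
Definition directed_path_graph (R : realType) (X : finType) (m : nat)
    (v : 'I_m -> X) (G : network R X) : Prop :=
  bijective v /\ forall i j : 'I_m, edge G (v i) (v j) <-> j = i.+1 :> nat.

(* The weights of the edges between distinct cells are otherwise arbitrary, and
   nothing is required of the weight of a pair (A, A). *)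
Definition quotient_graph (R : realType) (X : finType) (pi : {set {set X}})
    (G : network R X) (Gpi : network R {A : {set X} | A \in pi}) : Prop :=
  forall A B : {A : {set X} | A \in pi}, A != B ->
    edge Gpi A B <->
    exists x y : X, [/\ x \in val A, y \in val B & edge G x y].

(* Main.v *)
(* Every step of the trajectory either stays in a cell or crosses an edge of
   the quotient graph, so the cell of the first point reaches every cell and
   the cell of the last point is reached from every cell.  All these distances
   are finite, and for delta above their maximum the whole vertex set is a
   simplex: both maximal complexes are full simplices. *)

Require Import Defs.
From mathcomp Require Import all_boot all_order all_algebra.
From mathcomp Require Import all_classical all_reals.
From mathcomp Require Import ereal topology normedtype.

Set Implicit Arguments.
Unset Strict Implicit.
Unset Printing Implicit Defensive.

Import Order.TTheory GRing.Theory Num.Theory.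
Import numFieldNormedType.Exports.

Local Open Scope classical_set_scope.
Local Open Scope ring_scope.

(** The pointwise topology is the supremum of the topologies induced by the evaluations, so
    neighbourhoods may be tested on preimages of open sets under one evaluation at a time. *)
Lemma continuous_ptws (U : Type) (T V : topologicalType)
    (f : T -> {ptws U -> V}) :
  (forall u, continuous (fun t => f t u)) -> continuous f.
Proof.
move=> fc t; apply/cvg_sup => u A [_ [[W oW <-] Wft WA]].
apply: (filterS WA); apply: (fc u t).
exact: open_nbhs_nbhs.
Qed.

(** A full simplex is convex, so the straight-line homotopy [H] to the vertex [p] at [a] never
    leaves it. *)
Lemma contractible_full_simplex (R : realType) (X : finType) (a : X) :
  contractible_complex R (finset (fun s : {set X} => s != finset.set0)).
Proof.
pose p : {ptws X -> R} := fun x => (x == a)%:R.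
pose H (z : R * {ptws X -> R}) : {ptws X -> R} :=
  fun x => (1 - z.1) * z.2 x + z.1 * p x.
(* Coordinates with sum 1 cannot all vanish, so the support condition is automatic. *)
have simplexP (t : {ptws X -> R}) : (forall x, 0 <= t x) -> \sum_x t x = 1 ->
    realization (finset (fun s : {set X} => s != finset.set0)) t.
  move=> t0 t1; split=> //; rewrite inE; apply/eqP => supp0.
  move: t1; rewrite big1 => [/esym/eqP|x _]; first by rewrite oner_eq0.
  apply/eqP; apply: contraT => tx.
  have : x \in finset (fun x => t x != 0) by rewrite inE.
  by rewrite supp0 inE.
have sump : \sum_x p x = 1.
  by rewrite (bigD1 a)//= /p eqxx big1 ?addr0// => x /negbTE->.
exists p; first by apply: simplexP => // x; exact: ler0n.
exists H; split.
(* Continuity holds on the whole product: each coordinate of [H] is a polynomial in [z.1] and the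
   evaluation [z.2 x]. *)
- apply: continuous_subspaceT; apply: continuous_ptws => x z.
  have Fz : Filter (nbhs z) by exact: nbhs_filter.
  have zx : (fun w : R * {ptws X -> R} => w.2 x) @ z --> z.2 x.
    apply: (@cvg_comp _ _ _ snd (fun g : {ptws X -> R} => g x) _ (nbhs z.2)).
      exact: cvg_snd.
    exact: (@proj_continuous X (fun=> R) x z.2).
  have z1 : (fun w : R * {ptws X -> R} => w.1) @ z --> z.1 by exact: cvg_fst.
  have zN : (fun w : R * {ptws X -> R} => 1 - w.1) @ z --> 1 - z.1.
    exact: cvgB (cvg_cst (1 : R)) z1.
  exact: (cvgD (cvgM zN zx) (cvgM z1 (cvg_cst (p x)))).
- move=> t f /andP[t0 t1] [f0 sumf _]; apply: simplexP => [x|].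
    by rewrite addr_ge0// mulr_ge0// ?subr_ge0// ler0n.
  by rewrite big_split/= -!mulr_sumr sumf sump !mulr1 subrK.
- by move=> f _; apply/funext => x; rewrite /H subr0 mul1r mul0r addr0.
- by move=> f _; apply/funext => x; rewrite /H subrr mul1r mul0r add0r.
Qed.

(** Finitely many finite distances from [a] lie below a common [delta], beyond which [a] witnesses
    every nonempty set at once. *)
Lemma maximal_source_full (R : realType) (X : finType) (D : network R X)
    (a : X) :
  (forall x, (D a x < +oo)%E) ->
  maximal_complex (dowker_source D) =
    finset (fun s : {set X} => s != finset.set0).
Proof.
move=> Da; apply/setP => s; rewrite !inE; apply/asboolP/idP => [sF|s0].
  have [d] := filter_ex sF; by rewrite inE => /andP[].
have Dfin x : \forall d \near +oo%R, (D a x <= d%:E)%E.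
  have Dx : D a x = (fine (D a x))%:E.
    by rewrite fineK// ge0_fin_numE// weight_ge0.
  apply: filterS (nbhs_pinfty_ge (num_real (fine (D a x)))) => d.
  by rewrite {2}Dx lee_fin.
have : \forall d \near +oo%R, forall x, (D a x <= d%:E)%E.
  exact: filter_forall.
apply: filterS => d Dd; rewrite inE s0; apply/existsP; exists a.
by apply/forall_inP => x _.
Qed.

Lemma maximal_sink_full (R : realType) (X : finType) (D : network R X)
    (b : X) :
  (forall x, (D x b < +oo)%E) ->
  maximal_complex (dowker_sink D) =
    finset (fun s : {set X} => s != finset.set0).
Proof.
(* The sink complex of [D] is, by conversion, the source complex of the transposed network. *)
exact: (@maximal_source_full R X (Network (fun x y => weight_ge0 D y x)) b).
Qed.

(** Any path along edges bounds the infimum by a finite sum of finite weights. *)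
Lemma connect_dist_lt_pinfty (R : realType) (X : finType) (G : network R X)
    (x y : X) :
  connect (edge G) x y -> (dist G x y < +oo)%E.
Proof.
move=> /connectP[s Gs ->].
apply: (@le_lt_trans _ _ (path_weight G x s)).
  by apply: ereal_inf_lbound; exists s.
rewrite /path_weight.
elim: s x Gs => [|z s IHs] x /=; first by rewrite big_nil ltry.
by move=> /andP[xz zs]; rewrite big_cons lte_add_pinfty// IHs.
Qed.

Lemma directed_path_connect (R : realType) (X : finType) (m : nat)
    (v : 'I_m -> X) (G : network R X) (i j : 'I_m) :
  directed_path_graph v G -> (i <= j)%N -> connect (edge G) (v i) (v j).
Proof.
move=> [_ vG].
case: j => j; elim: j => [|j IHj] jm /=; rewrite leq_eqVlt => /predU1P[ij|//].
- by rewrite (_ : i = Ordinal jm)//; exact: val_inj.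
- by rewrite (_ : i = Ordinal jm)//; exact: val_inj.
- move=> ij; apply: connect_trans (IHj (ltnW jm) ij) (connect1 _).
  exact/vG.
Qed.

(** A path of [G] is projected to the cells edge by edge, by induction on its length with the
    starting cell [A] varying. *)
Lemma quotient_connect (R : realType) (X : finType) (pi : {set {set X}})
    (G : network R X) (Gpi : network R {A : {set X} | A \in pi})
    (A B : {A : {set X} | A \in pi}) (x y : X) :
  finset.partition pi (finset.setTfor X) -> quotient_graph G Gpi ->
  x \in val A -> y \in val B -> connect (edge G) x y ->
  connect (edge Gpi) A B.
Proof.
move=> /and3P[/eqP picover pitriv _] GpiE + + /connectP[s + yE].
rewrite {}yE {y}; elim: s x A => [|z s IHs] x A /= xA.
  (* Both cells contain [x], and the cells are disjoint. *)
  move=> xB _; rewrite (_ : A = B)//; apply: val_inj.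
  by rewrite -(finset.def_pblock pitriv (valP A) xA)
    -(finset.def_pblock pitriv (valP B) xB).
move=> sB /andP[xz zs].
have zpi : z \in finset.cover pi by rewrite picover inE.
pose C : {A : {set X} | A \in pi} :=
  exist _ (finset.pblock pi z) (finset.pblock_mem zpi).
have zC : z \in val C by rewrite finset.mem_pblock.
apply: connect_trans (IHs z C zC sB zs).
(* [GpiE] speaks only of distinct cells; a step inside one cell becomes the constant path. *)
have [->//|AC] := eqVneq A C.
by apply: connect1; apply/(GpiE _ _ AC); exists x, z.
Qed.

Theorem proposition24 (R : realType) (X : finType) (m : nat) (v : 'I_m -> X)
    (G : network R X) (pi : {set {set X}})
    (Gpi : network R {A : {set X} | A \in pi}) :
  (0 < m)%N ->
  directed_path_graph v G ->
  finset.partition pi (finset.setTfor X) ->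
  quotient_graph G Gpi ->
  contractible_complex R
    (maximal_complex (dowker_source (path_completion Gpi))) /\
  contractible_complex R
    (maximal_complex (dowker_sink (path_completion Gpi))).
Proof.
move=> m0 vG pipart GpiE; have [[w vK wK] _] := vG.
have /and3P[/eqP picover _ pi0] := pipart.
have cell x : exists A : {A : {set X} | A \in pi}, x \in val A.
  have xpi : x \in finset.cover pi by rewrite picover inE.
  exists (exist _ (finset.pblock pi x) (finset.pblock_mem xpi)).
  by rewrite finset.mem_pblock.
have point (A : {A : {set X} | A \in pi}) : exists i, v i \in val A.
  have /set0Pn[x xA] : val A != finset.set0.
    by apply: contraNneq pi0 => <-; exact: valP.
  by exists (w x); rewrite wK.
(* Writing the length as a successor gives access to [ord0] and [ord_max], the first and last
   points. *)
case: m m0 v vG w vK wK point => // m _ v vG w vK wK point.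
have [A vA] := cell (v ord0).
have [B vB] := cell (v ord_max).
split.
- rewrite (@maximal_source_full _ _ _ A).
    exact: contractible_full_simplex A.
  move=> C; have [i vC] := point C.
  apply/connect_dist_lt_pinfty/(quotient_connect pipart GpiE vA vC).
  exact: (directed_path_connect (i := ord0) vG (leq0n i)).
- rewrite (@maximal_sink_full _ _ _ B).
    exact: contractible_full_simplex B.
  move=> C; have [i vC] := point C.
  apply/connect_dist_lt_pinfty/(quotient_connect pipart GpiE vC vB).
  exact: (directed_path_connect (j := ord_max) vG (leq_ord i)).
Qed.
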